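(* Let $\mathcal{I}$ be a finite item set, let $\mathcal{P}_{\mathcal{G}}$ be a set of probability distributions on $\mathcal{I}$ (the model-induced item distributions), and let $\Phi_{\mathcal{G}}$ be a token interface, i.e. a map defined on $\mathcal{P}_{\mathcal{G}}$ with values in an arbitrary set. The following two statements are equivalent: 1. $\Phi_{\mathcal{G}}$ is globally ranking-sufficient, i.e. for all $p,\widetilde{p}\in\mathcal{P}_{\mathcal{G}}$, $\Phi_{\mathcal{G}}(p)=\Phi_{\mathcal{G}}(\widetilde{p})$ implies $\mathcal{R}(p)=\mathcal{R}(\widetilde{p})$. 2. There exists an item-level score mapping $\mathcal{S}_{\mathcal{G}}:\operatorname{Range}(\Phi_{\mathcal{G}})\to\mathbb{R}^{|\mathcal{I}|}$ such that, for every $p\in\mathcal{P}_{\mathcal{G}}$, $$\operatorname{argsort}^{\downarrow}_{i\in\mathcal{I}}\ \mathcal{S}_{\mathcal{G}}\bigl(\Phi_{\mathcal{G}}(p)\bigr)_i=\mathcal{R}(p).$$ Moreover, if these equivalent conditions do not hold, there exist two distributions $p,\widetilde{p}\in\mathcal{P}_{\mathcal{G}}$ satisfying $$\Phi_{\mathcal{G}}(p)=\Phi_{\mathcal{G}}(\widetilde{p}),\qquad \mathcal{R}(p)\neq\mathcal{R}(\widetilde{p}),$$ and no decoder $D:\operatorname{Range}(\Phi_{\mathcal{G}})\to\mathfrak{S}_{\mathcal{I}}$ and no item-level score mapping $\mathcal{S}:\operatorname{Range}(\Phi_{\mathcal{G}})\to\mathbb{R}^{|\mathcal{I}|}$ can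 recover the exact ranking for both; that is, no such $D$ satisfies both $D(\Phi_{\mathcal{G}}(p))=\mathcal{R}(p)$ and $D(\Phi_{\mathcal{G}}(\widetilde{p}))=\mathcal{R}(\widetilde{p})$, and no such $\mathcal{S}$ satisfies both $\operatorname{argsort}^{\downarrow}_{i\in\mathcal{I}}\mathcal{S}(\Phi_{\mathcal{G}}(p))_i=\mathcal{R}(p)$ and $\operatorname{argsort}^{\downarrow}_{i\in\mathcal{I}}\mathcal{S}(\Phi_{\mathcal{G}}(\widetilde{p}))_i=\mathcal{R}(\widetilde{p})$.
   Context: $\mathfrak{S}_{\mathcal{I}}$ denotes the set of total rankings of $\mathcal{I}$, i.e. orderings $(i_1,\ldots,i_n)$ of all $n=|\mathcal{I}|$ items. For a score vector $z\in\mathbb{R}^{|\mathcal{I}|}$ indexed by $\mathcal{I}$, $\operatorname{argsort}^{\downarrow}_{i\in\mathcal{I}} z_i\in\mathfrak{S}_{\mathcal{I}}$ is the total ranking of the items in decreasing order of score, with ties broken by a tie-breaking rule fixed once and for all (e.g. by a fixed linear order on $\mathcal{I}$). A user context $x$ is fixed; a model-induced item distribution $p=p(\cdot\mid x)$ assigns preference $p(i\mid x)$ to item $i$, and its exact ranking is $\mathcal{R}(p)=\operatorname{argsort}^{\downarrow}_{i\in\mathcal{I}}p(i\mid x)$. A token interface $\Phi_{\mathcal{G}}(p)$ is the token-level information through which $p$ is made available before item-level decoding; a decoder converts this information into an item ranking. *)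

(* Defs.v *)
From mathcomp Require Import all_boot all_order all_algebra.
From mathcomp Require Import boolp classical_sets reals.
Set Implicit Arguments.
Unset Strict Implicit.
Unset Printing Implicit Defensive.
Import Order.TTheory GRing.Theory Num.Theory.
Local Open Scope classical_set_scope.
Local Open Scope ring_scope.

Notation score R I := {ffun I -> R}.

Record distribution (R : realType) (I : finType) := Distribution {
  pmf :> score R I;
  pmf_ge0 : forall i, 0 <= pmf i;
  pmf_sum1 : \sum_i pmf i = 1
}.

(* Total rankings (i_1, ..., i_n) of all the n = #|I| items, best item first:
   a duplicate-free #|I|-tuple lists every item exactly once. *)
Definition ranking (I : finType) := {t : #|I|.-tuple I | uniq t}.

(* A deterministic tie-breaking rule: [tie_le tb z i j] means that i is placed
   before j if z i = z j. The linear order may depend on the score vector, so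
   that every single-valued argsort arises in this way; a linear order on I
   fixed independently of the scores is the special case [linear_tie_breaking]
   below. *)
Record tie_breaking (R : realType) (I : finType) := TieBreaking {
  tie_le : score R I -> rel I;
  tie_le_total : forall z, total (tie_le z);
  tie_le_anti : forall z, antisymmetric (tie_le z);
  tie_le_trans : forall z, transitive (tie_le z)
}.

Definition linear_tie_breaking (R : realType) (I : finType) (le : rel I)
    (le_total : total le) (le_anti : antisymmetric le)
    (le_trans : transitive le) : tie_breaking R I :=
  TieBreaking (fun _ : score R I => le_total) (fun _ => le_anti)
    (fun _ => le_trans).

Section Argsort.
Variables (R : realType) (I : finType) (tb : tie_breaking R I).
Implicit Types z : score R I.

Definition ranks_before z : rel I :=
  fun i j => (z j < z i) || (z i == z j) && tie_le tb z i j.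

Lemma ranks_before_total z : total (ranks_before z).
Proof.
move=> i j; rewrite /ranks_before.
by case: ltgtP => //= _; apply: tie_le_total.
Qed.

Lemma ranks_before_anti z : antisymmetric (ranks_before z).
Proof.
move=> i j; rewrite /ranks_before.
by case: ltgtP => //= _; apply: tie_le_anti.
Qed.

Lemma ranks_before_trans z : transitive (ranks_before z).
Proof.
move=> j i k; rewrite /ranks_before.
case/orP=> [ji|/andP[/eqP -> tij]]; last first.
  case/orP=> [->//|/andP[-> tjk]].
  by rewrite (tie_le_trans tij tjk) orbT.
by case/orP=> [kj|/andP[/eqP <- _]]; rewrite ?ji // (lt_trans kj ji).
Qed.

Lemma argsort_size z : size (sort (ranks_before z) (enum I)) == #|I|.
Proof. by rewrite size_sort cardE. Qed.

Lemma argsort_uniq z : uniq (Tuple (argsort_size z)).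
Proof. by rewrite /= sort_uniq enum_uniq. Qed.

Definition argsort z : ranking I := Sub (Tuple (argsort_size z)) (argsort_uniq z).

Lemma argsort_sorted z : sorted (ranks_before z) (val (argsort z)).
Proof. exact/sort_sorted/ranks_before_total. Qed.

Lemma argsort_decreasing z :
  sorted (fun i j => z j <= z i) (val (argsort z)).
Proof.
apply: sub_sorted (argsort_sorted z) => i j.
by case/orP=> [/ltW//|/andP[/eqP -> _]].
Qed.

Definition exact_ranking (p : distribution R I) : ranking I := argsort p.

End Argsort.

(* A token interface is a map Phi : P -> T, where the set P of model-induced
   distributions is coerced to the type {p | p \in P} and T is arbitrary. *)
Definition globally_ranking_sufficient (R : realType) (I : finType)
    (tb : tie_breaking R I) (P : set (distribution R I)) (T : Type)
    (Phi : P -> T) : Prop :=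
  forall p q : P, Phi p = Phi q ->
    exact_ranking tb (val p) = exact_ranking tb (val q).

(* [Phi] with its codomain restricted to its range. *)
Definition to_range (X T : Type) (f : X -> T) (x : X) : range f :=
  exist (fun y => y \in range f) (f x) (mem_set (imageP f (I : [set: X] x))).

(* Main.v *)
Require Import Defs.
From mathcomp Require Import all_boot all_order all_algebra.
From mathcomp Require Import boolp classical_sets reals.
Local Open Scope classical_set_scope.

(** Sufficiency says that the exact ranking is constant on the fibres of [Phi]. Hence any member of
    a fibre can supply scores for the whole fibre: [to_range_surj] and choice pick one. Conversely,
    whatever is computed from the token value alone agrees on a fibre ([to_range_eq]), so it cannot
    produce two different rankings there. *)

Lemma to_range_eq {X T : Type} {f : X -> T} {x y : X} :
  f x = f y -> to_range f x = to_range f y.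
Proof. by move=> fxy; apply: eq_exist. Qed.

Lemma to_range_surj {X T : Type} (f : X -> T) (y : range f) :
  exists x, to_range f x = y.
Proof.
case: y => y y_range; have [x _ fxy] := set_mem y_range.
by exists x; apply: eq_exist.
Qed.

Theorem proposition1 (R : realType) (I : finType) (tb : tie_breaking R I)
    (P : set (distribution R I)) (T : Type) (Phi : P -> T) :
  (globally_ranking_sufficient tb Phi <->
   exists S : range Phi -> score R I,
     forall p : P,
       argsort tb (S (to_range Phi p)) = exact_ranking tb (val p)) /\
  (~ globally_ranking_sufficient tb Phi ->
   exists p q : P,
     [/\ Phi p = Phi q,
         exact_ranking tb (val p) <> exact_ranking tb (val q),
         ~ (exists D : range Phi -> ranking I,
              D (to_range Phi p) = exact_ranking tb (val p) /\
              D (to_range Phi q) = exact_ranking tb (val q)) &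
         ~ (exists S : range Phi -> score R I,
              argsort tb (S (to_range Phi p)) = exact_ranking tb (val p) /\
              argsort tb (S (to_range Phi q)) = exact_ranking tb (val q))]).
Proof.
split; [split|].
- move=> suff; have [g gK] := choice (to_range_surj Phi).
  (* The score of a token value is the pmf of a chosen preimage. *)
  exists (fun y => pmf (val (g y))) => p.
  (* The chosen preimage may differ from [p], but [gK] puts it in the same fibre, and
     [exact_ranking] is by definition [argsort] of the pmf. *)
  by apply: (suff (g (to_range Phi p)) p); case: (gK (to_range Phi p)).
- move=> [S SR] p q /to_range_eq Phipq.
  by rewrite -!SR Phipq.
- move=> /existsNP[p /existsNP[q /not_implyP[Phipq Rpq]]].
  exists p, q; have range_pq := to_range_eq Phipq.
  (* [F] is the decoder in one case and the score mapping in the other; either takes a single value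
     at the common token of [p] and [q]. *)
  split=> // -[F [Fp Fq]]; apply: Rpq.
  + by rewrite -Fp -Fq range_pq.
  + by rewrite -Fp -Fq range_pq.
Qed.
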